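(* There is an absolute constant $c>0$ such that the following holds whenever $C_0$ is a sufficiently large constant. Let $\xi$ be an integer-valued random variable (possibly depending on $n$) which is $\alpha_n$-balanced with $\alpha_n \ge \frac{C_0\log n}{n}$, and assume that $\xi$ is bounded with probability one, i.e. $\mathbf{P}(|\xi|\le K_0)=1$ for some constant $K_0>0$ independent of $n$. For integers $m\ge n$ let $M_{n\times m}$ denote the $n\times m$ matrix whose entries are i.i.d. copies of $\xi$. Then for every $A,\varepsilon_0>0$ there exists $B=B(A,C_0,\varepsilon_0)$ such that, with $$u=\Big\lfloor B\Big(\frac{\log n}{\alpha_n}\log\Big(\frac{\log n}{\alpha_n}\Big)+\log n\Big)\Big\rfloor,$$ we have $$\mathbf{P}\Big(\mathbf{Cok}(M_{n\times(n+u)})\simeq\{id\}\Big)\ge 1-O\big(n^{-A}+e^{-c\alpha_n n}\big).$$ In particular: (1) if $\alpha_n$ is fixed (does not depend on $n$), then $$\mathbf{P}\Big(\mathbf{Cok}(M_{n\times\lfloor n+\log^{1+o(1)}n\rfloor})\simeq\{id\}\Big)\ge 1-O(n^{-\omega(1)});$$ (2) if $\alpha_n\ge\frac{(\log n)^{C}}{n}$ for a sufficiently large constant $C$, then $$\mathbf{P}\Big(\mathbf{Cok}(M_{n\times\lfloor(1+o(1))n\rfloor})\simeq\{id\}\Big)\ge 1-O(n^{-\omega(1)}).$$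
   Context: For $0<\alpha_n<1$, an integer-valued random variable $\xi$ is $\alpha_n$-balanced if for every prime $p$, $\max_{x\in\mathbf{Z}/p\mathbf{Z}}\mathbf{P}(\xi\equiv x \bmod p)\le 1-\alpha_n$; the parameter $\alpha_n$ may depend on $n$. The cokernel of an integer matrix $M_{n\times m}$ is $\mathbf{Cok}(M_{n\times m})=\mathbf{Z}^n/M_{n\times m}(\mathbf{Z}^m)$; it is trivial ($\simeq\{id\}$) exactly when $M_{n\times m}:\mathbf{Z}^m\to\mathbf{Z}^n$ is surjective. Asymptotic notation is as $n\to\infty$; implied constants may depend on $A,C_0,\varepsilon_0,K_0$ but not on $n$. The expression $o(1)$ in (1) and (2) stands for some sequence tending to $0$ as $n\to\infty$, for which the estimate holds; $O(n^{-\omega(1)})$ denotes a quantity that is $O(n^{-A'})$ for every fixed $A'>0$. The parameter $\varepsilon_0$ enters only through the dependence of $B$. *)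

(* Defs.v *)
From HB Require Import structures.
From mathcomp Require Import all_boot all_order all_algebra.
From mathcomp Require Import all_classical all_reals all_analysis.

Set Implicit Arguments.
Unset Strict Implicit.
Unset Printing Implicit Defensive.

Import Order.TTheory GRing.Theory Num.Theory.
Import numFieldNormedType.Exports.

Local Open Scope classical_set_scope.
Local Open Scope ring_scope.

(* The image M(Z^m) of an integer matrix as a subgroup of Z^n. *)
Definition mx_image (n m : nat) (M : 'M[int]_(n, m)) : {pred 'cV[int]_n} :=
  fun v => `[< exists w : 'cV[int]_m, M *m w = v >].

Lemma mx_image_zmod_closed (n m : nat) (M : 'M[int]_(n, m)) :
  zmod_closed (mx_image M).
Proof.
split=> [|_ _ /asboolP[v <-] /asboolP[w <-]]; apply/asboolP.
  by exists 0; rewrite mulmx0.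
by exists (v - w); rewrite mulmxBr.
Qed.

HB.instance Definition _ (n m : nat) (M : 'M[int]_(n, m)) :=
  GRing.isZmodClosed.Build 'cV[int]_n (mx_image M) (mx_image_zmod_closed M).

(* Z^n / M(Z^m) *)
Definition Cok (n m : nat) (M : 'M[int]_(n, m)) : zmodType :=
  Quotient.quot (mx_image M).

Definition trivial_group (G : zmodType) : Prop := forall x : G, x = 0.

HB.instance Definition _ := isPointed.Build int 0.

HB.instance Definition _ := @isMeasurable.Build default_measure_display
  int discrete_measurable discrete_measurable0
  discrete_measurableC discrete_measurableU.

(* Taking [A i := setT] outside a subset of the indices gives the product rule
   for every subfamily. *)
Definition mutually_independent (R : realType) (d d' : measure_display)
    (T : measurableType d) (T' : measurableType d') (P : probability T R)
    (I : finType) (X : I -> {RV P >-> T'}) : Prop :=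
  forall A : I -> set T', (forall i, measurable (A i)) ->
    P (\bigcap_(i in [set: I]) (X i @^-1` A i)) =
    (\prod_(i : I) fine (P (X i @^-1` A i)))%:E.

Definition same_law (R : realType) (d1 d2 d' : measure_display)
    (T1 : measurableType d1) (T2 : measurableType d2) (T' : measurableType d')
    (P1 : probability T1 R) (P2 : probability T2 R)
    (X1 : {RV P1 >-> T'}) (X2 : {RV P2 >-> T'}) : Prop :=
  forall A : set T', measurable A ->
    distribution P1 X1 A = distribution P2 X2 A.

Section integer_random_variable.
Context (R : realType) (d : measure_display) (S : measurableType d).
Context (Q : probability S R).
Implicit Types xi : {RV Q >-> int}.

(* For [p] prime, ['F_p] is Z/pZ and [k%:~R : 'F_p] is the residue of [k]. *)
Definition balanced (alpha : R) xi : Prop :=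
  forall p : nat, prime p -> forall x : 'F_p,
    (Q [set w | (xi w)%:~R = x] <= (1 - alpha)%:E)%E.

Definition as_bounded (K : R) xi : Prop :=
  Q [set w | `|(xi w)%:~R : R| <= K] = 1%E.

Definition iid_copies xi (d' : measure_display) (T : measurableType d')
    (P : probability T R) (n m : nat) (X : 'I_n -> 'I_m -> {RV P >-> int}) :
    Prop :=
  mutually_independent (fun ij : 'I_n * 'I_m => X ij.1 ij.2) /\
  forall i j, same_law (X i j) xi.

(* P(Cok(M_{n x m}) ~ {id}) >= q, for the n x m matrix with i.i.d. entries
   distributed as [xi], on whatever probability space it is realized (the
   probability depends only on the law of [xi]). *)
Definition prob_cok_trivial_ge xi (n m : nat) (q : R) : Prop :=
  forall (d' : measure_display) (T : measurableType d') (P : probability T R)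
    (X : 'I_n -> 'I_m -> {RV P >-> int}), iid_copies xi X ->
  (q%:E <=
   P [set w | trivial_group (Cok (\matrix_(i < n, j < m) X i j w))])%E.

Definition admissible (C0 K0 : R) (n : nat) (alpha : R) xi : Prop :=
  [/\ 0 < alpha < 1, C0 * ln n%:R / n%:R <= alpha,
      balanced alpha xi & as_bounded K0 xi].

End integer_random_variable.

(* The real number inside the floor is nonnegative for n >= 2 and B >= 0, where
   [Num.truncn] is the integer part. *)
Definition extra_columns (R : realType) (B alpha : R) (n : nat) : nat :=
  let L := ln n%:R / alpha in Num.truncn (B * (L * ln L + ln n%:R)).

(* Main.v *)
Require Import Defs.
From mathcomp Require Import all_boot all_order all_algebra perm.
From mathcomp Require Import all_classical all_reals all_analysis.
From mathcomp Require Import zify ring lra.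

(** Why the cokernel is trivial with high probability.

    A matrix over Z is onto iff it is onto modulo every prime
    (surjective_of_full_rank), so the columns are exposed one at a time and the
    rank of the exposed columns is followed modulo every prime p.

    One prime.  Let W be a subspace of (Z/pZ)^n of codimension k.  A vector
    with independent alpha-balanced entries lies in W with probability at most
    (1 - alpha)^k, because k of its coordinates are determined by the others
    (small_ball, trapped_column).  So the number of columns needed to go from
    codimension k to 0 is dominated by a sum of independent geometric variables
    with failure probabilities (1 - alpha)^j, j = 1, ..., k.  An exponential
    moment of this sum telescopes: with r = 1 - alpha / 2, the probability that
    t columns do not suffice is at most r^(t - k) / (1 - r)
    (deficient_prob).  Hence k + v columns fail with probability at most
    r^v / (1 - r), uniformly in p and k.

    All primes.  There are infinitely many primes, but the prime 2 serves as a
    reference.  A set of columns of rank h modulo 2 has an odd minor of size h;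
    it is a nonzero integer bounded in terms of n and of the bound on the
    entries, and modulo any prime which does not divide it the rank is at least
    h.  So, given the columns exposed so far, at most n (n + K) primes have a
    smaller rank than 2 (few_deficient_primes).  Suppose that the first
    n + v + 1 columns have rank n modulo 2, as they do outside an event of
    probability r^v / (1 - r).  Then at every earlier time the rank modulo 2 is
    at most v + 1 less than the number of columns, for otherwise the remaining
    columns could not complete it to n.  If p is deficient at the end, there
    is a first time i at which the rank modulo p falls below the rank modulo 2;
    just before, the two compare the other way, so at time i the rank modulo p
    is at least i - (v + 2), and n + 2v + 2 - i columns are still to come, at
    least v more than the codimension.  Conditionally on the first i columns,
    p is one of n (n + K) known primes and each of them fails with probability
    at most r^v / (1 - r).  Summing over i bounds the failure probability by
    (1 + (n + v + 2) n (n + K)) r^v / (1 - r)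
    (deficient_at_some_prime_prob).

    Asymptotics.  With v about 2 (A + 4) log n / alpha this is O(n^-A), so
    O(log n / alpha) extra columns are enough; for n large, each of the three
    numbers of columns in the theorem exceeds n by more than that. *)

Set Implicit Arguments.
Unset Strict Implicit.
Unset Printing Implicit Defensive.

Import Order.TTheory GRing.Theory Num.Theory.
Import numFieldNormedType.Exports.

Local Open Scope classical_set_scope.
Local Open Scope ring_scope.

(** * Finitely supported laws and their powers *)

Section FiniteLaw.
Context {R : realFieldType}.

(** A law with finite support is a list of pairs (value, weight).  Conditioning
    on the first columns is then the recursion on the length of a list
    (expect_iid_cat). *)
Definition expect (T : eqType) (l : seq (T * R)) (f : T -> R) : R :=
  \sum_(x <- l) x.2 * f x.1.

Definition is_law (T : eqType) (l : seq (T * R)) : Prop :=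
  all (fun x => 0 <= x.2) l /\ expect l (fun=> 1) = 1.

Fixpoint iid (T : eqType) (l : seq (T * R)) (t : nat) : seq (seq T * R) :=
  if t is t'.+1 then
    [seq (x.1 :: s.1, x.2 * s.2) | x <- l, s <- iid l t']
  else [:: ([::], 1)].

Lemma eq_expect (T : eqType) (l : seq (T * R)) f g :
  f =1 g -> expect l f = expect l g.
Proof. by move=> fg; apply: eq_bigr => x _; rewrite fg. Qed.

Lemma expectD (T : eqType) (l : seq (T * R)) f g :
  expect l (fun x => f x + g x) = expect l f + expect l g.
Proof.
by rewrite /expect -big_split; apply: eq_bigr => x _; rewrite mulrDr.
Qed.

Lemma expectZ (T : eqType) (l : seq (T * R)) a f :
  expect l (fun x => a * f x) = a * expect l f.
Proof. by rewrite /expect mulr_sumr; apply: eq_bigr => x _; rewrite mulrCA. Qed.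

Lemma expect_sum (T : eqType) (l : seq (T * R)) (I : Type) (r : seq I) f :
  expect l (fun x => \sum_(i <- r) f i x) = \sum_(i <- r) expect l (f i).
Proof.
by rewrite /expect exchange_big; apply: eq_bigr => x _; rewrite mulr_sumr.
Qed.

Lemma expect_cst (T : eqType) (l : seq (T * R)) a :
  is_law l -> expect l (fun=> a) = a.
Proof.
case=> _ l1; rewrite -[RHS]mulr1 -l1 -expectZ.
by apply: eq_expect => x; rewrite mulr1.
Qed.

Lemma expect_le_in (T : eqType) (l : seq (T * R)) f g : is_law l ->
  (forall x, x \in l -> f x.1 <= g x.1) -> expect l f <= expect l g.
Proof.
case=> /allP l0 _ fg; rewrite /expect big_seq [leRHS]big_seq.
by apply: ler_sum => x xl; rewrite ler_wpM2l ?fg ?l0.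
Qed.

Lemma expect_le (T : eqType) (l : seq (T * R)) f g : is_law l ->
  (forall x, f x <= g x) -> expect l f <= expect l g.
Proof. by move=> ll fg; apply: expect_le_in => // x _. Qed.

Lemma expect_iidS (T : eqType) (l : seq (T * R)) t f :
  expect (iid l t.+1) f =
  expect l (fun x => expect (iid l t) (fun s => f (x :: s))).
Proof.
rewrite /expect /= big_allpairs_dep; apply: eq_bigr => x _.
by rewrite mulr_sumr; apply: eq_bigr => s _ /=; rewrite mulrA.
Qed.

Lemma expect_iid0 (T : eqType) (l : seq (T * R)) f :
  expect (iid l 0) f = f [::].
Proof. by rewrite /expect /= big_seq1 mul1r. Qed.

Lemma expect_iid_cat (T : eqType) (l : seq (T * R)) a b f :
  expect (iid l (a + b)) f =
  expect (iid l a) (fun s => expect (iid l b) (fun s' => f (s ++ s'))).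
Proof.
elim: a f => [|a IHa] f; first by rewrite expect_iid0.
rewrite addSn !expect_iidS; apply: eq_expect => x; exact: IHa.
Qed.

Lemma iid_law (T : eqType) (l : seq (T * R)) t : is_law l -> is_law (iid l t).
Proof.
move=> ll; elim: t => [|t [t0 t1]].
  by split; rewrite /= ?ler01 ?expect_iid0.
split; last by rewrite expect_iidS t1 expect_cst.
apply/all_allpairsP => x s xl st; rewrite /= mulr_ge0//.
  by case: ll => /allP ->.
by move/allP: t0 => ->.
Qed.

Lemma mem_iid (T : eqType) (l : seq (T * R)) t x : x \in iid l t ->
  size x.1 = t /\ {subset x.1 <= map fst l}.
Proof.
elim: t x => [|t IHt] x; first by rewrite inE => /eqP ->.
case/allpairsP => -[y s] /= [yl /IHt [<- sl] ->]; split=> //= z.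
by rewrite inE => /predU1P[->|/sl//]; apply: map_f.
Qed.

Lemma iid_weight (T : eqType) (l : seq (T * R)) t (W : T -> R) :
  (forall x, x \in l -> x.2 = W x.1) ->
  forall x, x \in iid l t -> x.2 = \prod_(y <- x.1) W y.
Proof.
move=> lW; elim: t => [|t IHt] x.
  by rewrite inE => /eqP ->; rewrite big_nil.
by case/allpairsP => -[y s] /= [/lW yl /IHt st ->]; rewrite big_cons -yl st.
Qed.

Lemma uniq_iid (T : eqType) (l : seq (T * R)) t :
  uniq (map fst l) -> uniq (map fst (iid l t)).
Proof.
move=> lu; elim: t => //= t IHt.
rewrite map_allpairs.
have -> : [seq (x.1 :: s.1, x.2 * s.2).1 | x <- l, s <- iid l t] =
    [seq y :: s | y <- map fst l, s <- map fst (iid l t)].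
  rewrite allpairs_mapl; congr flatten.
  by apply: eq_map => y; rewrite -map_comp.
by apply: allpairs_uniq => // -[a b] [c d] _ _ /= [-> ->].
Qed.
End FiniteLaw.

(** * Exposing random columns modulo one prime *)

Definition residues (p n : nat) (c : seq int) : 'rV['F_p]_n :=
  \row_j (c`_j)%:~R.

(** The span is the row space of a square matrix, so that the spans of lists of
    all lengths have the same type. *)
Definition col_span (p n : nat) (s : seq (seq int)) : 'M['F_p]_n :=
  (\sum_(c <- s) <<residues p n c>>)%MS.

Definition rk (p n : nat) (s : seq (seq int)) : nat := \rank (col_span p n s).

Lemma rk_le p n s : (rk p n s <= n)%N.
Proof. exact: rank_leq_col. Qed.

Lemma rk_nil p n : rk p n [::] = 0%N.
Proof. by rewrite /rk /col_span big_nil mxrank0. Qed.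

Lemma rk_cat p n s s' : (rk p n s <= rk p n (s ++ s'))%N.
Proof. by rewrite /rk /col_span big_cat mxrankS ?addsmxSl. Qed.

Lemma mxrank_add_row (F : fieldType) m n (A : 'M[F]_(m, n)) (v : 'rV_n) :
  \rank (A + v)%MS = (\rank A + ~~ (v <= A)%MS)%N.
Proof.
case: (boolP (v <= A)%MS) => [vA|vNA].
  by rewrite addn0 (addsmx_idPl vA).
apply/eqP; rewrite addn1 eqn_leq; apply/andP; split.
  apply: leq_trans (leq_of_leqif (mxrank_adds_leqif A v)) _.
  by rewrite -[leqRHS]addn1 leq_add2l rank_leq_row.
rewrite (ltn_leqif (mxrank_leqif_sup (addsmxSl A v))).
by rewrite addsmx_sub submx_refl.
Qed.

Lemma rk_rcons p n s c :
  rk p n (rcons s c) = (rk p n s + ~~ (residues p n c <= col_span p n s)%MS)%N.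
Proof.
rewrite /rk {1}/col_span -cats1 big_cat big_seq1 /= -/(col_span p n s).
by rewrite (adds_eqmx (eqmx_refl _) (genmxE _)) mxrank_add_row.
Qed.

Lemma rk_gain p n s s' : (rk p n (s ++ s') <= rk p n s + size s')%N.
Proof.
elim: s' s => [|c s' IH] s; first by rewrite cats0 addn0.
rewrite -cat_rcons (leq_trans (IH _))// rk_rcons /= addnS -addSn.
by rewrite leq_add2r -[leqRHS]addn1 leq_add2l leq_b1.
Qed.

Section Growth.
Context {R : realFieldType} (mu : seq (int * R)) (q : R) (p : nat).
Hypotheses (mu_law : is_law mu) (q_ge0 : 0 <= q).
Hypothesis spread : forall a : 'F_p, expect mu (fun x => (x%:~R == a)%:R) <= q.

(** Induction on the coordinates of the random vector.  If removing the first
    row h of H does not lower the rank, condition on the first coordinate.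
    Otherwise some phi is killed by the other rows but not by h, and applying
    it to the equation forces the value of the first coordinate modulo p, at
    the cost of a factor q. *)
Lemma small_ball n k (H : 'M['F_p]_(n, k)) v :
  expect (iid mu n) (fun c => (residues p n c *m H == v)%:R) <= q ^+ \rank H.
Proof.
elim: n H v => [|n IHn] H v.
  by rewrite expect_iid0 (flatmx0 H) mxrank0 expr0 lern1 leq_b1.
pose h : 'rV_k := usubmx (H : 'M['F_p]_(1 + n, k)).
pose H' : 'M['F_p]_(n, k) := dsubmx (H : 'M['F_p]_(1 + n, k)).
have HE : H = col_mx h H' by rewrite vsubmxK.
have splitE x c : residues p n.+1 (x :: c) *m H =
    x%:~R *: h + residues p n c *m H'.
  rewrite -mul_scalar_mx -mul_row_col -HE; congr (_ *m _).
  by apply/rowP => j; rewrite !mxE; case: splitP => i ->; rewrite !mxE ?ord1.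
have rHE : \rank H = \rank (H' + h)%MS by rewrite addsmxC addsmxE -HE.
case: (boolP (h <= H')%MS) => hH'.
  have -> : \rank H = \rank H' by rewrite rHE mxrank_add_row hH' addn0.
  rewrite expect_iidS -(expect_cst (q ^+ \rank H') mu_law).
  apply: expect_le => // x; apply: le_trans (IHn H' (v - x%:~R *: h)).
  apply: expect_le => [|c]; first exact: iid_law.
  by rewrite splitE addrC -subr_eq opprK ler_nat; case: eqP.
have [phi H'phi hphi] :
    exists2 phi : 'cV_k, H' *m phi = 0 & (h *m phi) 0 0 != 0.
  move: (hH'); rewrite submxE => /rV0Pn[j hj].
  exists (col j (cokermx H')); first by rewrite colE mulmxA mulmx_coker mul0mx.
  by rewrite colE mulmxA -colE mxE.
have -> : \rank H = (\rank H').+1.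
  by rewrite rHE mxrank_add_row hH' addn1.
rewrite exprS.
(* the only value of the first coordinate compatible with the equation *)
pose a : 'F_p := (v *m phi) 0 0 / (h *m phi) 0 0.
apply: (@le_trans _ _
    (expect mu (fun x => q ^+ \rank H' * (x%:~R == a)%:R))); last first.
  by rewrite expectZ [leRHS]mulrC ler_wpM2l ?exprn_ge0 ?spread.
rewrite expect_iidS; apply: expect_le => // x; case: eqP => xE.
  rewrite mulr1; apply: le_trans (IHn H' (v - x%:~R *: h)).
  apply: expect_le => [|c]; first exact: iid_law.
  by rewrite splitE addrC ler_nat; case: eqP => // <-; rewrite addrK eqxx.
rewrite mulr0 -[leRHS](expect_cst _ (iid_law n mu_law)).
apply: expect_le => [|c]; first exact: iid_law.
rewrite splitE; case: eqP => // vE; case: xE.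
rewrite /a -vE mulmxDl -mulmxA H'phi.
by rewrite mulmx0 addr0 -scalemxAl mxE mulfK.
Qed.

(** A subspace of codimension k is the kernel of a matrix of rank k. *)
Lemma trapped_column n (A : 'M['F_p]_n) :
  expect (iid mu n) (fun c => (residues p n c <= A)%MS%:R) <=
  q ^+ (n - \rank A).
Proof.
rewrite -mxrank_coker; apply: le_trans (small_ball _ 0).
by apply: expect_le => [|c]; rewrite ?submxE //; exact: iid_law.
Qed.

Context (r : R).
Hypotheses (r_gt0 : 0 < r) (r_lt1 : r < 1) (q_le : q <= r ^+ 2).

(** The function f(k, t) = r^(t - k) (1 - r^(2k+1)) / (1 - r) dominates the
    failure probability from codimension k with t columns left, as it satisfies
    f(k, t + 1) >= r^(2k) f(k, t) + (1 - r^(2k)) f(k - 1, t), and a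
    column fails to lower the codimension with probability at most
    q^k <= r^(2k).  The denominators are cleared in the statement, where r^k
    appears on the left because t may be smaller than k. *)
Lemma deficient_prob n t s0 k : k = (n - rk p n s0)%N ->
  r ^+ k * (1 - r) *
    expect (iid (iid mu n) t) (fun s => (rk p n (s0 ++ s) < n)%N%:R)
  <= r ^+ t * (1 - r ^+ k.*2.+1).
Proof.
have r_ge0 := ltW r_gt0.
have le1 j : r ^+ j <= 1 by rewrite exprn_ile1// ltW.
have ge0 j : 0 <= r ^+ j by rewrite exprn_ge0.
elim: t s0 k => [|t IHt] s0 k kE.
  rewrite expect_iid0 expr0 mul1r cats0.
  apply: (@le_trans _ _ (1 - r)).
    rewrite mulrAC ler_piMl ?subr_ge0 ?(ltW r_lt1)//.
    by rewrite mulr_ile1 ?ge0 ?le1 ?ler0n ?lern1 ?leq_b1.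
  by rewrite lerB// exprS ler_piMr.
have [k0|k_gt0] := posnP k.
  rewrite [expect _ _](_ : _ = 0) ?mulr0 ?mulr_ge0 ?subr_ge0//.
  rewrite -[RHS](expect_cst 0 (iid_law t.+1 (iid_law n mu_law))).
  apply: eq_expect => s; rewrite ltnNge (leq_trans _ (rk_cat _ _ _ _))//.
  by rewrite -subn_eq0 -kE k0.
have [j kj] : exists j, k = j.+1 by exists k.-1; rewrite prednK.
pose b c : R := (residues p n c <= col_span p n s0)%MS%:R.
have step c : r ^+ k * (1 - r) * expect (iid (iid mu n) t)
    (fun s => (rk p n (s0 ++ c :: s) < n)%N%:R) <=
    r * (r ^+ t * (1 - r ^+ j.*2.+1)) +
    (r ^+ t * (1 - r ^+ k.*2.+1) - r * (r ^+ t * (1 - r ^+ j.*2.+1))) * b c.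
  under eq_expect do rewrite -cat_rcons.
  have := IHt (rcons s0 c) _ erefl; rewrite rk_rcons /b.
  case: (_ <= _)%MS => /=.
    by rewrite addn0 -kE mulr1 => IH; rewrite [leRHS]addrC subrK.
  have -> : (n - (rk p n s0 + true) = j)%N by rewrite subnDA -kE kj subn1.
  move=> IH; rewrite mulr0 addr0 kj exprS -!mulrA ler_wpM2l//.
  by rewrite mulrA.
rewrite expect_iidS -expectZ.
apply: le_trans (expect_le (iid_law n mu_law) step) _.
rewrite expectD expect_cst ?expectZ; last exact: iid_law.
have Eb : expect (iid mu n) b <= r ^+ k.*2.
  apply: le_trans (trapped_column _) _; rewrite -/(rk p n s0) -kE.
  by rewrite -mul2n exprM lerXn2r ?nnegrE ?exprn_ge0.
have [y_ge0 y_le1] := (ge0 j.*2.+1, le1 j.*2.+1).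
have k2E : r ^+ k.*2 = r * r ^+ j.*2.+1 by rewrite kj doubleS exprS.
have k21E : r ^+ k.*2.+1 = r ^+ 2 * r ^+ j.*2.+1 by rewrite kj doubleS -exprD.
rewrite k21E k2E in Eb *; rewrite (exprS r t).
move: (r ^+ j.*2.+1) y_ge0 y_le1 Eb => y y_ge0 y_le1 Eb.
move: (expect (iid mu n) _) Eb => e Eb.
rewrite [leLHS](_ : _ =
  r ^+ t * (r * (1 - y) + (1 - r ^+ 2 * y - r * (1 - y)) * e)); last by ring.
rewrite (mulrC r (r ^+ t)) -[leRHS]mulrA ler_wpM2l//.
apply: (@le_trans _ _ (r * (1 - y) + (1 - r ^+ 2 * y - r * (1 - y)) * (r * y))).
  rewrite lerD2l ler_wpM2l//.
  have -> : 1 - r ^+ 2 * y - r * (1 - y) = (1 - r) * (1 + r * y) by ring.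
  by rewrite mulr_ge0 ?subr_ge0 ?(ltW r_lt1) ?addr_ge0 ?mulr_ge0.
(* the difference of the two sides *)
have : 0 <= r ^+ 2 * y * ((1 - r) * (1 - y)).
  by rewrite !mulr_ge0 ?subr_ge0 ?exprn_ge0 ?(ltW r_lt1).
nra.
Qed.

Lemma deficient_prob_le n t s0 v : (n - rk p n s0 + v <= t)%N ->
  expect (iid (iid mu n) t) (fun s => (rk p n (s0 ++ s) < n)%N%:R) <=
  r ^+ v / (1 - r).
Proof.
move=> tv; have := @deficient_prob n t s0 _ erefl.
set k := (n - _)%N in tv *; move=> H.
rewrite ler_pdivlMr ?subr_gt0// -(ler_pM2l (exprn_gt0 k r_gt0)).
rewrite -exprD mulrCA mulrC; apply: le_trans H _.
apply: (@le_trans _ _ (r ^+ t)).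
  by rewrite ler_piMr ?exprn_ge0 ?lerBlDr ?lerDl ?exprn_ge0// ltW.
by rewrite ler_wiXn2l // ltW.
Qed.
End Growth.

(** * Integer matrices modulo primes *)

Definition mod_mx (p m n : nat) (M : 'M[int]_(m, n)) : 'M['F_p]_(m, n) :=
  map_mx intr M.

Lemma exists_maximal_minor (F : fieldType) m n (A : 'M[F]_(m, n)) :
  exists f g, (mxsub f g A : 'M[F]_(\rank A)) \in unitmx.
Proof.
have full : row_full (rowsub (maxrankfun A) A)^T.
  by rewrite /row_full mxrank_tr -[_ == _]/(row_free _); exact: maxrowsub_free.
exists (maxrankfun A), (fullrankfun full).
rewrite (_ : mxsub _ _ A =
    (rowsub (fullrankfun full) (rowsub (maxrankfun A) A)^T)^T).
  by rewrite unitmx_tr fullrowsub_unit.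
by apply/matrixP => i j; rewrite !mxE.
Qed.

Lemma rank_mxsub_unit (F : fieldType) m n k (A : 'M[F]_(m, n))
    (f : 'I_k -> 'I_m) (g : 'I_k -> 'I_n) :
  mxsub f g A \in unitmx -> (k <= \rank A)%N.
Proof.
move=> /mxrank_unit rU.
rewrite -{1}rU -[A in mxsub _ _ A]mulmx1 mxsub_mul rowsubE.
by rewrite -mulmxA; apply: leq_trans (mxrankM_maxr _ _) (mxrankM_maxl _ _).
Qed.

(** The Leibniz formula.  Only the logarithm of this bound will count, so it can
    be crude. *)
Lemma absz_det_le k K (D : 'M[int]_k) : (forall i j, (`|D i j| <= K)%N) ->
  (`|\det D| <= k`! * K ^ k)%N.
Proof.
move=> DK; rewrite -lez_nat abszE.
apply: le_trans (ler_norm_sum _ _ _) _.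
apply: (@le_trans _ _ (\sum_(s : 'S_k) (K ^ k)%:Z)).
  apply: ler_sum => s _; rewrite normrM normr_sign mul1r normr_prod.
  rewrite -[in leRHS](card_ord k) -prod_nat_const -natz natr_prod.
  by apply: ler_prod => i _; rewrite normr_ge0 natz lez_nat DK.
by rewrite sumr_const card_Sn -mulr_natr natz -PoszM mulnC.
Qed.

Lemma fact_le k : (k`! <= 2 ^ (k * k))%N.
Proof.
elim: k => // k IHk; rewrite factS.
rewrite (leq_trans (leq_mul (ltnW (ltn_expl k.+1 (ltnSn 1))) IHk))// -expnD.
by rewrite leq_exp2l// mulSn leq_add2l leq_mul2l leqnSn orbT.
Qed.

Lemma size_primes_le N d :
  (0 < d)%N -> (d <= 2 ^ N)%N -> (size (primes d) <= N)%N.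
Proof.
move=> d_gt0 dN; rewrite -(@leq_exp2l 2)//; apply: leq_trans dN.
rewrite [leqRHS](prod_prime_decomp d_gt0) prime_decompE big_map /=.
have : {subset primes d <= primes d} by [].
(* induction over a list of prime divisors of d; each factor p ^ logn p d is at
   least 2 *)
elim: {1 3 4}(primes d) => [|p s IH] sd /=; first by rewrite big_nil.
rewrite big_cons expnS leq_mul ?IH// => [|x xs].
  2: by rewrite sd// inE xs orbT.
have pd : p \in primes d by rewrite sd ?mem_head.
have p_pr : prime p by move: pd; rewrite mem_primes => /andP[].
rewrite (leq_trans (prime_gt1 p_pr))// -[leqLHS]expn1 leq_exp2l ?prime_gt1//.
by rewrite logn_gt0.
Qed.

(** The exceptional primes are the divisors of a maximal odd minor, and a number
    at most 2^N has at most N prime divisors. *)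
Lemma few_deficient_primes K m n (M : 'M[int]_(m, n)) :
  (forall i j, (`|M i j| <= K)%N) ->
  exists2 ps : seq nat, (size ps <= n * (n + K))%N &
    forall p, prime p -> (\rank (mod_mx p M) < \rank (mod_mx 2 M))%N ->
      p \in ps.
Proof.
move=> MK; have [f [g fgU]] := exists_maximal_minor (mod_mx 2 M).
set k := \rank (mod_mx 2 M) in f g fgU *.
have kn : (k <= n)%N by exact: rank_leq_col.
pose d := `|\det (mxsub f g M)|%N.
have modE p : mxsub f g (mod_mx p M) = mod_mx p (mxsub f g M).
  by apply/matrixP => i j; rewrite !mxE.
have unitE p : prime p -> (mxsub f g (mod_mx p M) \in unitmx) = ~~ (p %| d)%N.
  move=> p_pr; rewrite modE unitmxE det_map_mx unitfE.
  by rewrite -(dvdz_pcharf (pchar_Fp p_pr)).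
have d_gt0 : (0 < d)%N.
  by rewrite lt0n; apply: contraTneq fgU => d0; rewrite unitE// d0.
exists (primes d).
  apply: size_primes_le => //; apply: leq_trans (absz_det_le _) _ => [i j|].
    by rewrite mxE; exact: MK.
  apply: leq_trans (leq_mul (fact_le k) (_ : _ <= (2 ^ K) ^ k)%N) _.
    by case: (posnP k) => [->//|k_gt0]; rewrite leq_exp2r// ltnW// ltn_expl.
  by rewrite -expnM -expnD leq_exp2l// mulnC -mulnDr; nia.
move=> p p_pr; rewrite mem_primes p_pr d_gt0 /= => lt.
apply: contraLR lt => pd.
by rewrite -leqNgt (@rank_mxsub_unit _ _ _ _ _ f g)// unitE.
Qed.

(** Surjectivity modulo 2 gives W with M W congruent to the identity, so
    d = |det (M W)| is odd, in particular nonzero, and d Z^n lies in the image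
    by Cramer's rule.  Surjectivity modulo a prime divisor p of d allows d to be
    replaced by d / p: write v = M w + p u, so that (d / p) v is the sum of
    M ((d / p) w) and d u.  Descend to d = 1. *)
Lemma surjective_of_full_rank n m (M : 'M[int]_(n, m)) :
  (forall p, prime p -> \rank (mod_mx p M) = n) ->
  forall v : 'cV[int]_n, exists w, M *m w = v.
Proof.
move=> full.
have lift p (v : 'cV_n) : prime p -> exists w u, v = M *m w + p%:Z *: u.
  move=> p_pr; have free : row_full (mod_mx p M)^T.
    by rewrite /row_full mxrank_tr full.
  have /submxP[D DE] := submx_full (mod_mx p v)^T free.
  pose w : 'cV_m := \col_j (D 0 j : nat)%:Z; exists w.
  have wE : mod_mx p w = D^T.
    by apply/matrixP => i j; rewrite !mxE ord1 -pmulrn natr_Zp.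
  have dv i : (p%:Z %| (v - M *m w) i ord0)%Z.
    rewrite (dvdz_pcharf (pchar_Fp p_pr)).
    have : mod_mx p (v - M *m w) = 0.
      rewrite /mod_mx map_mxB map_mxM -/(mod_mx p w) -/(mod_mx p v) wE.
      rewrite -[X in X - _]trmxK.
      by rewrite DE trmx_mul trmxK subrr.
    by move/matrixP/(_ i ord0); rewrite mxE [RHS]mxE => ->.
  exists (\col_i ((v - M *m w) i ord0 %/ p%:Z)%Z).
  rewrite (_ : p%:Z *: _ = v - M *m w) ?[M *m w + _]addrC ?subrK//.
  by apply/colP => i; rewrite mxE [X in _ * X = _]mxE mulrC divzK ?dv.
have kill2 (v : 'cV_n) : exists w u, v = M *m w + 2%:Z *: u := lift 2%N v isT.
have [/= W [U WU]] : exists W U, 1%:M = M *m W + 2%:Z *: U.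
  have /fin_all_exists [W /fin_all_exists [U WU]] :=
    fun j : 'I_n => kill2 (col j 1%:M).
  exists (\matrix_(i, j) W j i 0), (\matrix_(i, j) U j i 0).
  apply/matrixP => i j; have /colP/(_ i) := WU j.
  rewrite mxE => ->; rewrite !mxE; congr (_ + _).
  by apply: eq_bigr => a _; rewrite !mxE.
pose N := `|\det (M *m W)|%N.
have N_gt0 : (0 < N)%N.
  rewrite lt0n absz_eq0; apply/negP => /eqP d0.
  have : (\det (mod_mx 2 (1%:M - 2%:Z *: U))) = 0.
    by rewrite {1}WU addrK det_map_mx d0 rmorph0.
  rewrite /mod_mx map_mxB map_mx1 map_mxZ [X in X *: _](_ : _ = 0).
    2: exact/val_inj.
  by rewrite scale0r subr0 det1 => /eqP; rewrite oner_eq0.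
have : exists2 d, (0 < d)%N &
    forall v : 'cV[int]_n, exists w, M *m w = d%:Z *: v.
  exists N => // v.
  exists (Num.sg (\det (M *m W)) *: (W *m (\adj (M *m W) *m v))).
  rewrite -scalemxAr !mulmxA mul_mx_adj mul_scalar_mx scalerA.
  by rewrite -normrEsg -abszE.
case=> d; elim/ltn_ind: d => d IHd d_gt0 dM.
have [d1|d_gt1] := leqP d 1.
  move=> v; have [w] := dM v; have -> : d = 1%N by lia.
  by rewrite scale1r => <-; exists w.
have p_pr := pdiv_prime d_gt1.
apply: (IHd (d %/ pdiv d)%N).
- by rewrite ltn_Pdiv ?prime_gt1.
- by rewrite divn_gt0 ?pdiv_gt0// pdiv_leq.
move=> v; have [w [u ->]] := lift _ v p_pr; have [w' w'E] := dM u.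
exists ((d %/ pdiv d)%:Z *: w + w').
rewrite mulmxDr w'E -scalemxAr scalerDr scalerA -PoszM divnK//.
exact: pdiv_dvd.
Qed.

(** * All primes at once *)

Definition rows_mx (t n : nat) (s : seq (seq int)) : 'M[int]_(t, n) :=
  \matrix_(i < t, j < n) (nth [::] s i)`_j.

Lemma rkE p n s : rk p n s = \rank (mod_mx p (rows_mx (size s) n s)).
Proof.
have rowE (i : 'I_(size s)) :
    row i (mod_mx p (rows_mx (size s) n s)) = residues p n (nth [::] s i).
  by apply/rowP => j; rewrite !mxE.
apply: eqmx_rank; rewrite /col_span (big_nth [::]) big_mkord.
apply/andP; split.
  by apply/sumsmx_subP => i _; rewrite genmxE -rowE row_sub.
by apply/row_subP => i; rewrite rowE (sumsmx_sup i)// genmxE.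
Qed.

Lemma expect_take_drop (R : realFieldType) (T : eqType) (l : seq (T * R)) i m
    (f : seq T -> seq T -> R) : (i <= m)%N ->
  expect (iid l m) (fun s => f (take i s) (drop i s)) =
  expect (iid l i) (fun s1 => expect (iid l (m - i)) (f s1)).
Proof.
move=> im; rewrite -{1}(subnKC im) expect_iid_cat.
apply: eq_big_seq => x /mem_iid[xi _]; congr (_ * _).
by apply: eq_expect => s; rewrite take_size_cat ?drop_size_cat.
Qed.

Section AllPrimes.
Context {R : realFieldType} (mu : seq (int * R)) (q r : R) (K n v : nat).
Hypothesis mu_law : is_law mu.
Hypothesis mu_bounded : forall x, x \in map fst mu -> (`|x| <= K)%N.
Hypothesis spread : forall p, prime p -> forall a : 'F_p,
  expect mu (fun x => (x%:~R == a)%:R) <= q.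
Hypotheses (q_ge0 : 0 <= q) (r_gt0 : 0 < r) (r_lt1 : r < 1).
Hypothesis q_le : q <= r ^+ 2.

Let col_law := iid_law n mu_law.

(** The event that a prime is behind 2 after the first i columns s1 but not by
    much, and is still deficient after the remaining columns s2.  The inequality
    on i leaves v more columns than the codimension. *)
Definition overtaken (i : nat) (s1 s2 : seq (seq int)) : bool :=
  `[< exists2 p, prime p & [&& (rk p n s1 < rk 2 n s1)%N,
      (i <= rk p n s1 + v.+2)%N & (rk p n (s1 ++ s2) < n)%N] >].

(** For fixed s1 only the few primes of few_deficient_primes are concerned, and
    each of them is treated by deficient_prob_le with the remaining columns. *)
Lemma overtaken_prob i m : (n + v.*2.+2 <= m)%N -> (i <= m)%N ->
  expect (iid (iid mu n) m) (fun s => (overtaken i (take i s) (drop i s))%:R) <=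
  (n * (n + K))%:R * (r ^+ v / (1 - r)).
Proof.
move=> nm im.
rewrite (expect_take_drop _ (fun s1 s2 => (overtaken i s1 s2)%:R))//.
have bound_ge0 : 0 <= r ^+ v / (1 - r).
  by rewrite divr_ge0 ?exprn_ge0 ?subr_ge0// ltW.
rewrite -[leRHS](expect_cst _ (iid_law i col_law)).
apply: expect_le_in => [|[s1 w] /mem_iid/= [_ s1_supp]]; first exact: iid_law.
have [|ps ps_size psP] :=
    @few_deficient_primes K _ _ (rows_mx (size s1) n s1).
  move=> j k; rewrite mxE; have [kc|] := ltnP k (size (nth [::] s1 j)).
    have /s1_supp /mapP[[c w'] /mem_iid /= [_ c_supp] cE] :=
      mem_nth [::] (ltn_ord j).
    by rewrite cE in kc *; apply/mu_bounded/c_supp/mem_nth.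
  by move=> ?; rewrite nth_default.
apply: (@le_trans _ _ (\sum_(p <- ps) r ^+ v / (1 - r))); last first.
  rewrite big_const_seq count_predT iter_addr_0 -[leLHS]mulr_natl.
  by rewrite ler_wpM2r ?ler_nat.
apply: (@le_trans _ _ (\sum_(p <- ps) expect (iid (iid mu n) (m - i)) (fun s2 =>
   ((prime p && (i <= rk p n s1 + v.+2))%N && (rk p n (s1 ++ s2) < n)%N)%:R))).
  rewrite -expect_sum; apply: expect_le => [|s2]; first exact: iid_law.
  rewrite /overtaken; case: asboolP => [[p p_pr /and3P[lt ip def]]|_].
    2: by apply: sumr_ge0 => p _; rewrite ler0n.
  have pps : p \in ps by apply: psP; rewrite -?rkE.
  by rewrite (big_rem p pps) /= p_pr ip def lerDl sumr_ge0.
apply: ler_sum => p _; case: (boolP (prime p && _)) => [/andP[p_pr ip]|_] /=.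
  apply: (deficient_prob_le mu_law q_ge0 (spread p_pr) r_gt0 r_lt1 q_le).
  by have := rk_le p n s1; lia.
by rewrite expect_cst //; exact: iid_law.
Qed.

(** A deficient prime forces either a deficiency of 2 after n + v + 1 columns or
    an overtaking at one of the times i <= n + v + 1, namely the first time at
    which p is behind 2. *)
Lemma deficient_at_some_prime_prob m : (n + v.*2.+2 <= m)%N ->
  expect (iid (iid mu n) m)
    (fun s => `[< exists2 p, prime p & (rk p n s < n)%N >]%:R) <=
  (1 + (n + v.+2) * (n * (n + K)))%:R * (r ^+ v / (1 - r)).
Proof.
move=> nm; pose T := (n + v.+1)%N.
have Tm : (T <= m)%N by rewrite /T; lia.
apply: (@le_trans _ _ (expect (iid (iid mu n) m) (fun s =>
   (rk 2 n (take T s) < n)%N%:R +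
   \sum_(i < T.+1) (overtaken i (take i s) (drop i s))%:R))).
  apply: expect_le_in => [|[s w] /mem_iid/= [sm _]]; first exact: iid_law.
  case: asboolP => [[p p_pr def]|_]; last first.
    by rewrite addr_ge0 ?sumr_ge0 ?ler0n// => i _; rewrite ler0n.
  have [_|full2] := ltnP (rk 2 n (take T s)) n.
    by rewrite lerDl sumr_ge0// => i _; rewrite ler0n.
  pose late i := (rk p n (take i s) < rk 2 n (take i s))%N.
  have lateT : late T.
    apply: leq_trans full2; apply: leq_trans def; rewrite ltnS.
    by rewrite -[in leqRHS](cat_take_drop T s) rk_cat.
  have ex_late : exists i, late i by exists T.
  (* i is the first time at which p is behind 2 *)
  have [i late_i min_i] := ex_minnP ex_late.
  have iT : (i < T.+1)%N by rewrite ltnS min_i.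
  have [i0|i_gt0] := posnP i.
    by move: late_i; rewrite i0 /late take0 !rk_nil ltnn.
  have ontime : (rk 2 n (take i.-1 s) <= rk p n (take i.-1 s))%N.
    by rewrite leqNgt; apply/negP => /min_i; lia.
  have lag : (i <= rk p n (take i s) + v.+2)%N.
    (* each of the columns i, ..., T raises the rank modulo 2 by at most one *)
    have g2 : (n <= rk 2 n (take i.-1 s) + (T - i.-1))%N.
      apply: leq_trans full2 _.
      have -> : take T s = take i.-1 s ++ drop i.-1 (take T s).
        by rewrite -{1}(cat_take_drop i.-1 (take T s)) take_takel//; lia.
      apply: leq_trans (rk_gain _ _ _ _) _.
      by rewrite size_drop size_takel// sm.
    have gp : (rk p n (take i.-1 s) <= rk p n (take i s))%N.
      rewrite -[in leqRHS](cat_take_drop i.-1 (take i s)).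
      by rewrite take_takel ?leq_pred// rk_cat.
    by rewrite /T in g2 iT; lia.
  rewrite (bigD1 (Ordinal iT))//= (_ : overtaken _ _ _ = true); last first.
    by apply/asboolP; exists p => //; rewrite cat_take_drop; apply/and3P.
  by rewrite add0r lerDl sumr_ge0// => j _; rewrite ler0n.
rewrite expectD expect_sum natrD mulrDl lerD//.
  rewrite mul1r (expect_take_drop _ (fun s1 _ => (rk 2 n s1 < n)%N%:R))//.
  under eq_expect do rewrite (expect_cst _ (iid_law _ col_law)).
  apply: (deficient_prob_le (s0 := [::]) mu_law q_ge0 (@spread 2 isT)
    r_gt0 r_lt1 q_le).
  by rewrite rk_nil /T; lia.
apply: (@le_trans _ _
    (\sum_(i < T.+1) (n * (n + K))%:R * (r ^+ v / (1 - r)))).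
  apply: ler_sum => i _; apply: overtaken_prob => //.
  by apply: leq_trans Tm; rewrite -ltnS.
by rewrite sumr_const card_ord -[leLHS]mulr_natl mulrA -natrM /T !addnS.
Qed.
End AllPrimes.

(** * Trivial cokernels and countably valued variables *)

Lemma trivial_cok_of_full_rank n m (M : 'M[int]_(n, m)) :
  (forall p, prime p -> \rank (mod_mx p M) = n) -> trivial_group (Cok M).
Proof.
move=> full; elim/quotW => v; have [w Mw] := surjective_of_full_rank full v.
have vM : v - 0 \in mx_image M by rewrite subr0; apply/asboolP; exists w.
by rewrite Quotient.idealrBE in vM; rewrite (eqP vM) [LHS]raddf0.
Qed.

Section CountableValues.
Context {R : realType} {d : measure_display} {T : measurableType d}.
Context (P : probability T R) (V : countType) (Y : T -> V).
Hypothesis mY : forall y, measurable (Y @^-1` [set y]).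

Lemma measurable_countable_preimage B : measurable (Y @^-1` B).
Proof.
have -> : Y @^-1` B = \bigcup_(y : V) (Y @^-1` (B `&` [set y])).
  apply/seteqP; split=> [w Bw|w [y _ []]//].
  by exists (Y w) => //; split.
apply: countable_bigcupT_measurable; first exact: countableP.
move=> y; have [By|By] := pselect (B y).
  by rewrite (_ : _ `&` _ = [set y]) //; apply/seteqP; split => [z []//|z ->].
rewrite (_ : _ `&` _ = set0) ?preimage_set0 //.
by apply/seteqP; split => // z [Bz /= zy]; apply: By; rewrite -zy.
Qed.

Lemma prob_in_seq (l : seq V) : uniq l ->
  P (Y @^-1` [set` l]) = (\sum_(y <- l) fine (P (Y @^-1` [set y])))%:E.
Proof.
elim: l => [|y l IHl] /=.
  by rewrite big_nil set_nil preimage_set0 measure0.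
case/andP=> yl ul; rewrite big_cons EFinD -IHl// fineK ?fin_num_measure//.
have -> : [set` y :: l] = [set y] `|` [set` l].
  apply/seteqP; split=> z /=; first by rewrite inE => /predU1P[]; [left|right].
  by rewrite inE => -[->|->]; rewrite ?eqxx ?orbT.
rewrite preimage_setU measureU//; first exact: measurable_countable_preimage.
by apply/seteqP; split => // w [/= -> /=]; rewrite (negbTE yl).
Qed.
End CountableValues.

(** * From finite laws to random matrices *)

Definition ints (K : nat) : seq int := [seq i%:Z - K%:Z | i <- iota 0 K.*2.+1].

Lemma mem_ints K x : (x \in ints K) = (`|x| <= K)%N.
Proof.
apply/mapP/idP => [[i]|xK]; first by rewrite mem_iota => ? ->; lia.
by exists (absz (x + K%:Z)); rewrite ?mem_iota; lia.
Qed.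

Lemma uniq_ints K : uniq (ints K).
Proof. by rewrite map_inj_uniq ?iota_uniq// => i j; lia. Qed.

Section EntryLaw.
Context {R : realType} {d : measure_display} {S : measurableType d}.
Context (Q : probability S R) (xi : {RV Q >-> int}).

Definition pmf (x : int) : R := fine (Q (xi @^-1` [set x])).

Definition entry_law (K : nat) : seq (int * R) :=
  [seq (x, pmf x) | x <- ints K].

Let m_xi (A : set int) : measurable (xi @^-1` A).
Proof. by rewrite -[_ @^-1` _]setTI; apply: measurable_funPT. Qed.

Lemma entry_support K : map fst (entry_law K) = ints K.
Proof. by rewrite -map_comp map_id. Qed.

Lemma expect_entry_law K f :
  expect (entry_law K) f = \sum_(x <- ints K) pmf x * f x.
Proof. by rewrite /expect big_map. Qed.

Lemma entry_is_law K0 K :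
  K0 <= K%:R -> as_bounded K0 xi -> is_law (entry_law K).
Proof.
move=> K0K bnd; split.
  by apply/allP => _ /mapP[x _ ->] /=; exact: fine_ge0.
rewrite expect_entry_law; under eq_bigr do rewrite mulr1.
apply/EFin_inj; rewrite -(prob_in_seq Q (fun x => m_xi [set x]) (uniq_ints K)).
apply/eqP; rewrite eq_le probability_le1 //=.
rewrite -bnd; apply: le_measure; rewrite ?inE; try exact: m_xi.
  exact: (m_xi [set x | `|x%:~R : R| <= K0]).
move=> w /=; rewrite mem_ints => xK.
have := le_trans xK K0K.
by rewrite -intr_norm [K%:R]pmulrn ler_int -abszE lez_nat.
Qed.

Lemma entry_spread alpha K p : balanced alpha xi -> prime p ->
  forall a : 'F_p, expect (entry_law K) (fun x => (x%:~R == a)%:R) <= 1 - alpha.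
Proof.
move=> bal p_pr a; rewrite expect_entry_law.
have -> : \sum_(x <- ints K) pmf x * (x%:~R == a)%:R =
    \sum_(x <- [seq x <- ints K | x%:~R == a]) pmf x.
  rewrite big_filter [RHS]big_mkcond; apply: eq_bigr => x _.
  by case: eqP; rewrite ?mulr1 ?mulr0.
have ul := filter_uniq (fun x => x%:~R == a) (uniq_ints K).
rewrite -lee_fin -(prob_in_seq Q (fun x => m_xi [set x]) ul).
apply: le_trans (bal p p_pr a).
apply: le_measure; rewrite ?inE; try exact: m_xi.
  exact: (m_xi [set x | x%:~R = a]).
by move=> w; rewrite /preimage /mkset mem_filter => /andP[/eqP].
Qed.
End EntryLaw.

Section MatrixLaw.
Context {R : realType} {d d' : measure_display} {S : measurableType d}.
Context {T : measurableType d'} (Q : probability S R) (P : probability T R).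
Context (xi : {RV Q >-> int}) (n m : nat) (X : 'I_n -> 'I_m -> {RV P >-> int}).
Hypothesis iidX : iid_copies xi X.

Let Y w : 'M[int]_(n, m) := \matrix_(i, j) X i j w.

Let mX i j (A : set int) : measurable (X i j @^-1` A).
Proof. by rewrite -[_ @^-1` _]setTI; apply: measurable_funPT. Qed.

Let fiberE M : Y @^-1` [set M] =
  \bigcap_(ij in [set: 'I_n * 'I_m]) (X ij.1 ij.2 @^-1` [set M ij.1 ij.2]).
Proof.
apply/seteqP; split=> w /=.
  by move=> <- [i j] _ /=; rewrite mxE.
by move=> XM; apply/matrixP => i j; rewrite mxE; exact: (XM (i, j)).
Qed.

Let mY M : measurable (Y @^-1` [set M]).
Proof.
by rewrite fiberE; apply: fin_bigcap_measurable => //= ij _; exact: mX.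
Qed.

Lemma prob_fiber M :
  fine (P (Y @^-1` [set M])) = \prod_j \prod_i pmf xi (M i j).
Proof.
have [ind law] := iidX; rewrite fiberE.
rewrite (ind (fun ij => [set M ij.1 ij.2])) //= exchange_big pair_big /=.
by apply: eq_bigr => -[i j] _ /=; rewrite -[P _]/(distribution P (X i j) _) law.
Qed.

(** The matrices of the finite law are distinct and their weights are the
    probabilities of the disjoint events that the random matrix takes these
    values. *)
Lemma expect_le_prob K (good : set 'M[int]_(n, m)) :
  ((expect (iid (iid (entry_law xi K) n) m)
     (fun s => `[< good (rows_mx m n s)^T >]%:R))%:E <=
   P (Y @^-1` good))%E.
Proof.
set L := iid _ m; pose mat s := (rows_mx m n s)^T.
have shape x : x \in L -> size x.1 = m /\ (forall c, c \in x.1 -> size c = n).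
  move=> /mem_iid[xm xs]; split => // c /xs /mapP[y /mem_iid[yn _] ->].
  exact: yn.
have weight x : x \in L -> x.2 = fine (P (Y @^-1` [set mat x.1])).
  move=> xL; have [xm xn] := shape _ xL.
  rewrite prob_fiber.
  rewrite (@iid_weight _ _ _ _ (fun c => \prod_(y <- c) pmf xi y) _ _ xL).
    rewrite (big_nth [::]) xm big_mkord; apply: eq_bigr => j _.
    have jn : size (nth [::] x.1 j) = n by apply/xn/mem_nth; rewrite xm.
    by rewrite (big_nth 0) jn big_mkord; apply: eq_bigr => i _; rewrite !mxE.
  by apply: iid_weight => _ /mapP[y _ ->].
pose l := [seq M <- map mat (map fst L) | `[< good M >]].
have ul : uniq l.
  apply/filter_uniq; rewrite map_inj_in_uniq; last first.
    move=> s s' /mapP[x /shape[xm xn] ->] /mapP[y /shape[ym yn] ->] xy.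
    apply: (@eq_from_nth _ [::]) => [|j]; rewrite xm ?ym// => jm.
    have xjn : size (nth [::] x.1 j) = n by apply/xn/mem_nth; rewrite xm.
    have yjn : size (nth [::] y.1 j) = n by apply/yn/mem_nth; rewrite ym.
    apply: (@eq_from_nth _ 0) => [|i]; rewrite xjn ?yjn// => lin.
    by move/matrixP/(_ (Ordinal lin) (Ordinal jm)): xy; rewrite !mxE.
  by do 2!apply: uniq_iid; rewrite entry_support uniq_ints.
have -> : expect L (fun s => `[< good (rows_mx m n s)^T >]%:R) =
    \sum_(M <- l) fine (P (Y @^-1` [set M])).
  rewrite /l big_filter -map_comp big_map [RHS]big_mkcond.
  apply: eq_big_seq => x xL.
  by rewrite (weight _ xL) -/(mat x.1) /=; case: ifP; rewrite ?mulr1 ?mulr0.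
rewrite -(prob_in_seq P mY ul); apply: le_measure; rewrite ?inE.
- exact: measurable_countable_preimage.
- exact: measurable_countable_preimage.
by move=> w /=; rewrite mem_filter => /andP[/asboolP].
Qed.
End MatrixLaw.

(** With r = 1 - alpha / 2, r^2 >= 1 - alpha and 1 - r = alpha / 2. *)
Lemma prob_cok_trivial_finite (R : realType) (d : measure_display)
    (S : measurableType d) (Q : probability S R) (xi : {RV Q >-> int})
    (alpha K0 : R) (K n m v : nat) :
  0 < alpha < 1 -> K0 <= K%:R -> balanced alpha xi -> as_bounded K0 xi ->
  (n + v.*2.+2 <= m)%N ->
  prob_cok_trivial_ge xi n m
    (1 - (1 + (n + v.+2) * (n * (n + K)))%:R *
         ((1 - alpha / 2) ^+ v / (alpha / 2))).
Proof.
move=> /andP[alpha_gt0 alpha_lt1] K0K bal bnd nm d' T P X iidX.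
have mu_law := entry_is_law K0K bnd.
apply: le_trans (expect_le_prob iidX K [set M | trivial_group (Cok M)]).
set L := iid _ m; have L_law : is_law L by apply: iid_law (iid_law _ mu_law).
rewrite lee_fin lerBlDr.
pose bad s : R := `[< exists2 p, prime p & (rk p n s < n)%N >]%:R.
have r1 : 1 - (1 - alpha / 2) = alpha / 2 by ring.
apply: le_trans (lerD (lexx _) (_ : expect L bad <= _)); last first.
  rewrite -[X in _ / X]r1.
  apply: (@deficient_at_some_prime_prob _ _ (1 - alpha)) => //.
  - by move=> x; rewrite entry_support mem_ints.
  - by move=> p p_pr a; exact: entry_spread.
  - by lra.
  - by lra.
  - by lra.
  - by rewrite expr2; nra.
rewrite -expectD -[leLHS](expect_cst 1 L_law).
apply: expect_le_in => // x /mem_iid[xm _]; rewrite /bad.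
case: (asboolP (exists2 _, _ & _)) => [_|ndef]; first by rewrite lerDr ler0n.
rewrite addr0 asboolT //=.
apply: trivial_cok_of_full_rank => p p_pr.
have -> : mod_mx p (rows_mx m n x.1)^T = (mod_mx p (rows_mx m n x.1))^T.
  by rewrite /mod_mx map_trmx.
rewrite mxrank_tr -xm -rkE; apply/eqP; rewrite eqn_leq rk_le leqNgt.
by apply/negP => lt; apply: ndef; exists p.
Qed.

(** * The failure probability for large n *)

Section Asymptotics.
Context {R : realType}.
Implicit Types A alpha : R.

(** With v about 2 (A + 4) log n / alpha one has r^v = O(n^(- A - 4)), and n^4
    absorbs the n^3 of the union bound and 1 / (1 - r) = 2 / alpha <= 2 n. *)
Lemma failure_bound A K alpha (n v : nat) : 0 < A -> 0 < alpha < 1 ->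
  1 <= ln (n%:R : R) -> ln n%:R / n%:R <= alpha ->
  (v%:R : R) <= 2 * (A + 4) * (ln n%:R / alpha) < v.+1%:R ->
  (1 + (n + v.+2) * (n * (n + K)))%:R * ((1 - alpha / 2) ^+ v / (alpha / 2)) <=
  (1 + (2 * A + 11) * K.+1%:R) * 2 * expR 1 * n%:R `^ (- A).
Proof.
move=> A_gt0 /andP[a_gt0 a_lt1] ln1 lna /andP[v_le v_gt].
have n_gt0 : (0 < n)%N by case: n ln1 {lna v_le v_gt} => //; rewrite ln0//; lra.
pose N : R := n%:R; rewrite -/N in ln1 lna v_le v_gt *.
have N1 : 1 <= N by rewrite ler1n.
have N_gt0 : 0 < N by lra.
have Nexp : expR (ln N) = N by rewrite lnK// posrE.
have L_le : ln N / alpha <= N.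
  by rewrite ler_pdivrMr// mulrC -ler_pdivrMr.
have ainv : (alpha / 2)^-1 <= 2 * N.
  rewrite invfM invrK mulrC ler_pM2l// -[leLHS]mul1r.
  apply: le_trans L_le; apply: ler_wpM2r; rewrite ?invr_ge0 //; lra.
have pow : (1 - alpha / 2) ^+ v <= N `^ (- A) * expR 1 * N ^- 4.
  apply: (@le_trans _ _ (expR (- (alpha / 2) * v%:R))).
    rewrite expRM_natr lerXn2r ?nnegrE ?expR_ge0//; first by lra.
    by rewrite (le_trans _ (expR_ge1Dx _)).
  rewrite /powR gt_eqF// -{2}Nexp -expRM_natr -expRN -!expRD ler_expR.
  have : alpha * (2 * (A + 4) * (ln N / alpha)) <= alpha * v.+1%:R.
    by rewrite ler_pM2l// ltW.
  have -> : alpha * (2 * (A + 4) * (ln N / alpha)) = 2 * (A + 4) * ln N.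
    by field; rewrite gt_eqF.
  by rewrite -[v.+1%:R]natr1 => ?; nra.
have count : (1 + (n + v.+2) * (n * (n + K)))%:R <=
    (1 + (2 * A + 11) * K.+1%:R) * N ^+ 3.
  have vN : v%:R <= 2 * (A + 4) * N.
    by apply: le_trans v_le _; rewrite ler_pM2l//; nra.
  have N3 : 1 <= N ^+ 3 by rewrite exprn_ege1.
  have t1 : n%:R + v.+2%:R <= (2 * A + 11) * N :> R.
    by rewrite -/N -addn2 natrD; lra.
  have t2 : n%:R + K%:R <= K.+1%:R * N :> R.
    by rewrite -/N -natr1; have : 0 <= K%:R :> R by []; nra.
  rewrite natrD natrM natrD natrM natrD -/N [leRHS]mulrDl mul1r.
  apply: lerD => //.
  have -> : (2 * A + 11) * K.+1%:R * N ^+ 3 =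
     (2 * A + 11) * N * (N * (K.+1%:R * N)) by ring.
  apply: ler_pM => //; first by rewrite addr_ge0.
    by rewrite !mulr_ge0 ?addr_ge0.
  by rewrite ler_pM2l.
apply: (@le_trans _ _ ((1 + (2 * A + 11) * K.+1%:R) * N ^+ 3 *
    (N `^ (- A) * expR 1 * N ^- 4 * (2 * N)))).
  apply: ler_pM => //; last apply: ler_pM => //.
  - by rewrite divr_ge0 ?exprn_ge0//; lra.
  - by rewrite exprn_ge0//; lra.
  - by rewrite invr_ge0; lra.
rewrite le_eqVlt; apply/orP; left; apply/eqP.
by field; rewrite gt_eqF.
Qed.

(** With v the integer part of 2 (A + 4) log n / alpha, the lower bound on m
    gives n + 2 v + 2 <= m. *)
Lemma prob_cok_trivial_asymp A (K0 : R) : 0 < A ->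
  exists2 C : R, 0 <= C & forall (n m : nat) alpha (d : measure_display)
    (S : measurableType d) (Q : probability S R) (xi : {RV Q >-> int}),
  1 <= ln (n%:R : R) -> admissible 1 K0 n alpha xi ->
  n%:R + 4 * (A + 4) * (ln n%:R / alpha) + 2 <= m%:R ->
  prob_cok_trivial_ge xi n m (1 - C * n%:R `^ (- A)).
Proof.
move=> A_gt0; pose K := (Num.truncn K0).+1.
have C_ge0 : 0 <= (1 + (2 * A + 11) * K.+1%:R) * 2 * expR 1.
  by rewrite !mulr_ge0 ?expR_ge0// addr_ge0// mulr_ge0//; lra.
exists ((1 + (2 * A + 11) * K.+1%:R) * 2 * expR 1) => //.
move=> n m alpha d S Q xi ln1 [a01 lna bal bnd] nm d' T P X iidX.
have /andP[a_gt0 a_lt1] := a01; rewrite mul1r in lna.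
pose v := Num.truncn (2 * (A + 4) * (ln n%:R / alpha)).
have /andP[v_le v_gt] : (v%:R : R) <= 2 * (A + 4) * (ln n%:R / alpha) < v.+1%:R.
  by apply: truncn_itv; rewrite !mulr_ge0// ?invr_ge0; lra.
have K0K : K0 <= K%:R by apply/ltW/truncnS_gt.
have nvm : (n + v.*2.+2 <= m)%N.
  rewrite -(ler_nat R); apply: le_trans nm.
  have -> : (n + v.*2.+2)%:R = n%:R + 2 * v%:R + 2 :> R.
    by rewrite -addn2 addnA -muln2 [LHS]natrD [X in X + _]natrD natrM mulrC.
  by lra.
apply: le_trans (prob_cok_trivial_finite a01 K0K bal bnd nvm iidX).
by rewrite lee_fin lerD2l lerN2; apply: failure_bound => //; rewrite v_le.
Qed.
End Asymptotics.

(** * The number of extra columns *)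

Lemma ln_cvgy (R : realType) (u : nat -> R) :
  u @ \oo --> +oo -> ln (u n) @[n --> \oo] --> +oo.
Proof.
move=> /cvgryPge uy; apply/cvgryPge => M; apply: filterS (uy (expR M)) => n Mu.
by rewrite -ler_expR lnK// posrE (lt_le_trans (expR_gt0 M)).
Qed.

Lemma inv_sqrt_cvg0 (R : realType) (u : nat -> R) :
  u @ \oo --> +oo -> (Num.sqrt (u n))^-1 @[n --> \oo] --> 0.
Proof.
move=> /cvgryPge uy; apply/cvgr0Pnorm_le => e e_gt0.
apply: filterS (uy (e ^- 2)) => n eu.
have s_gt0 : 0 < Num.sqrt (u n).
  by rewrite sqrtr_gt0 (lt_le_trans _ eu)// invr_gt0 exprn_gt0.
rewrite ger0_norm ?invr_ge0 ?(ltW s_gt0)// invf_ple ?posrE//.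
by rewrite (le_trans (ler_norm _))// -sqrtr_sqr ler_wsqrtr// exprVn.
Qed.

Lemma inv_sqrt_mul (R : realType) (x : R) :
  0 < x -> (Num.sqrt x)^-1 * x = Num.sqrt x.
Proof.
move=> x_gt0; rewrite -[X in _ * X]sqr_sqrtr ?ltW// expr2 mulKf//.
by rewrite gt_eqF ?sqrtr_gt0.
Qed.

Lemma sqrt_cvgy (R : realType) (u : nat -> R) :
  u @ \oo --> +oo -> Num.sqrt (u n) @[n --> \oo] --> +oo.
Proof.
move=> /cvgryPge uy; apply/cvgryPge => M; apply: filterS (uy (M ^+ 2)) => n Mu.
by rewrite (le_trans (ler_norm M))// -sqrtr_sqr ler_wsqrtr.
Qed.

Lemma ln_natr_cvgy (R : realType) : ln (n%:R : R) @[n --> \oo] --> +oo.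
Proof. by apply: ln_cvgy; exact: cvgr_idn. Qed.

Lemma admissible_mono (R : realType) (C0 K0 alpha : R) n (d : measure_display)
    (S : measurableType d) (Q : probability S R) (xi : {RV Q >-> int}) :
  1 <= C0 -> 0 <= ln (n%:R : R) ->
  admissible C0 K0 n alpha xi -> admissible 1 K0 n alpha xi.
Proof.
move=> C0_ge1 ln0 [a01 lna bal bnd]; split => //; apply: le_trans lna.
by rewrite ler_wpM2r ?invr_ge0// ler_wpM2r.
Qed.

Theorem theorem1p4 (R : realType) :
  exists c Cmin Cmin' : R, 0 < c /\
  forall C0 : R, Cmin <= C0 ->
  [/\ forall A eps0 : R, 0 < A -> 0 < eps0 ->
      exists2 B : R, 0 < B &
      forall K0 : R, 0 < K0 ->
      exists K : R,
      \forall n \near \oo,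
      forall (alpha : R) (d : measure_display) (S : measurableType d)
        (Q : probability S R) (xi : {RV Q >-> int}),
      admissible C0 K0 n alpha xi ->
      prob_cok_trivial_ge xi n (n + extra_columns B alpha n)
        (1 - K * (n%:R `^ (- A) + expR (- (c * alpha * n%:R)))),

      forall K0 alpha : R, 0 < K0 -> 0 < alpha < 1 ->
      exists2 delta : nat -> R, delta @ \oo --> 0 &
      forall A' : R, 0 < A' ->
      exists K : R,
      \forall n \near \oo,
      forall (d : measure_display) (S : measurableType d)
        (Q : probability S R) (xi : {RV Q >-> int}),
      admissible C0 K0 n alpha xi ->
      prob_cok_trivial_ge xi n
        (Num.truncn (n%:R + ln n%:R `^ (1 + delta n))) (1 - K * n%:R `^ (- A')) &

      forall C : R, Cmin' <= C ->
      forall K0 : R, 0 < K0 ->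
      exists2 delta : nat -> R, delta @ \oo --> 0 &
      forall A' : R, 0 < A' ->
      exists K : R,
      \forall n \near \oo,
      forall (alpha : R) (d : measure_display) (S : measurableType d)
        (Q : probability S R) (xi : {RV Q >-> int}),
      admissible C0 K0 n alpha xi -> ln n%:R `^ C / n%:R <= alpha ->
      prob_cok_trivial_ge xi n
        (Num.truncn ((1 + delta n) * n%:R)) (1 - K * n%:R `^ (- A'))].
Proof.
have /cvgryPge ln_ge := @ln_natr_cvgy R.
have /cvgryPge sqrt_ln_ge := sqrt_cvgy (@ln_natr_cvgy R).
have /cvgryPge sqrt_lnln_ge := sqrt_cvgy (ln_cvgy (@ln_natr_cvgy R)).
(* Cmin = 1 gives log n / alpha <= n, and Cmin' = 2 gives
   log n / alpha <= n / log n *)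
exists 1, 1, 2; split=> // C0 C0_ge1; split.
- move=> A _ A_gt0 _; exists (4 * (A + 4) + 3); first by lra.
  move=> K0 _; have [K K_ge0 HK] := prob_cok_trivial_asymp K0 A_gt0; exists K.
  near=> n => alpha d S Q xi adm d' T P X iidX.
  have ln1 : 1 <= ln (n%:R : R) by near: n; exact: ln_ge.
  have lne : expR 1 <= ln (n%:R : R) by near: n; exact: ln_ge.
  have adm1 : admissible 1 K0 n alpha xi by apply: admissible_mono adm; lra.
  have [/andP[a_gt0 a_lt1] _ _ _] := adm1.
  (* log (log n / alpha) >= 1, so the number of extra columns is at least
     B log n / alpha - 1 *)
  have L_ge : ln (n%:R : R) <= ln n%:R / alpha.
    by rewrite ler_pdivlMr// ler_piMr; lra.
  have lnL : 1 <= ln (ln (n%:R : R) / alpha).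
    by rewrite -ler_expR lnK ?posrE; lra.
  apply: le_trans (HK n _ alpha _ _ Q xi ln1 adm1 _ _ _ _ _ iidX).
    by rewrite lee_fin lerD2l lerN2 ler_wpM2l// lerDl expR_ge0.
  rewrite natrD -addrA lerD2l /extra_columns.
  set y := _ * (_ + _); have : y < (Num.truncn y)%:R + 1.
    by rewrite natr1; exact: truncnS_gt.
  suff : (4 * (A + 4) + 3) * (ln n%:R / alpha) <= y by lra.
  apply: ler_wpM2l; first by lra.
  by rewrite -[leLHS]addr0 lerD// -1?[leLHS]mulr1 ?ler_wpM2l//; lra.
- move=> K0 alpha _ /andP[a_gt0 a_lt1].
  (* (log n)^(1 + delta n) is then (log n) exp (sqrt (log log n)) *)
  exists (fun n => (Num.sqrt (ln (ln n%:R)))^-1).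
    by apply: inv_sqrt_cvg0; do 2!apply: ln_cvgy; exact: cvgr_idn.
  move=> A A_gt0; have [K K_ge0 HK] := prob_cok_trivial_asymp K0 A_gt0.
  exists K.
  near=> n => d S Q xi adm.
  have ln1 : 1 <= ln (n%:R : R) by near: n; exact: ln_ge.
  have lnln : 4 * (A + 4) / alpha + 3 <= Num.sqrt (ln (ln (n%:R : R))).
    by near: n; exact: sqrt_lnln_ge.
  apply: (HK n _ alpha) => //; first by apply: admissible_mono adm; lra.
  set y := n%:R + _ `^ _; have : y < (Num.truncn y)%:R + 1.
    by rewrite natr1; exact: truncnS_gt.
  suff : 4 * (A + 4) * (ln n%:R / alpha) + 3 <=
      ln n%:R `^ (1 + (Num.sqrt (ln (ln n%:R)))^-1).
    by rewrite /y; lra.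
  have s_gt0 : 0 < Num.sqrt (ln (ln (n%:R : R))).
    apply: lt_le_trans lnln; rewrite ltr_wpDl// divr_ge0; lra.
  rewrite powRD; last by rewrite gt_eqF ?implybT//; lra.
  rewrite powRr1; last by lra.
  have -> : ln n%:R `^ (Num.sqrt (ln (ln n%:R)))^-1 =
      expR (Num.sqrt (ln (ln (n%:R : R)))).
    rewrite /powR gt_eqF; last by lra.
    by rewrite inv_sqrt_mul// -sqrtr_gt0.
  apply: (@le_trans _ _ (ln n%:R * (4 * (A + 4) / alpha + 3))).
    rewrite [leRHS]mulrDr [X in _ <= X + _](_ : _ = 4 * (A + 4) * (ln n%:R / alpha)).
      by rewrite lerD2l; lra.
    by field; rewrite gt_eqF.
  rewrite ler_wpM2l//; first by lra.
  apply: le_trans lnln _; apply: le_trans (expR_ge1Dx _); lra.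
- move=> C C_ge2 K0 _.
  (* n / sqrt (log n) is of larger order than n / log n >= log n / alpha *)
  exists (fun n => (Num.sqrt (ln n%:R))^-1).
    by apply: inv_sqrt_cvg0; exact: ln_natr_cvgy.
  move=> A A_gt0; have [K K_ge0 HK] := prob_cok_trivial_asymp K0 A_gt0.
  exists K.
  near=> n => alpha d S Q xi adm a_ge.
  have ln1 : 1 <= ln (n%:R : R) by near: n; exact: ln_ge.
  have s_ge : 4 * (A + 4) + 3 <= Num.sqrt (ln (n%:R : R)).
    by near: n; exact: sqrt_ln_ge.
  have n_gt0 : 0 < n%:R :> R.
    rewrite ltr0n lt0n; apply: contraTneq ln1 => ->.
    by rewrite ln0// -ltNge ltr01.
  have adm1 : admissible 1 K0 n alpha xi by apply: admissible_mono adm; lra.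
  have [/andP[a_gt0 a_lt1] _ _ _] := adm1.
  apply: (HK n _ alpha) => //.
  set y := _ * n%:R; have : y < (Num.truncn y)%:R + 1.
    by rewrite natr1; exact: truncnS_gt.
  have -> : y = n%:R + n%:R / Num.sqrt (ln n%:R).
    by rewrite /y mulrDl mul1r [X in _ + X]mulrC.
  suff : 4 * (A + 4) * (ln n%:R / alpha) + 3 <= n%:R / Num.sqrt (ln n%:R).
    by lra.
  have lna : ln n%:R / alpha <= n%:R / ln n%:R.
    rewrite ler_pdivrMr// mulrAC ler_pdivlMr; last by lra.
    rewrite -expr2 mulrC -ler_pdivrMr//; apply: le_trans a_ge.
    rewrite ler_wpM2r ?invr_ge0 ?ler0n// -powR_mulrn; last by lra.
    exact: ler_powR.
  have n_ge : 1 <= n%:R / ln (n%:R : R).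
    by rewrite ler_pdivlMr ?mul1r ?(ltW (ln_sublinear _))//; lra.
  have -> : n%:R / Num.sqrt (ln n%:R) =
      Num.sqrt (ln n%:R) * (n%:R / ln (n%:R : R)).
    rewrite -[X in _ = X * _]inv_sqrt_mul; last by lra.
    by field; rewrite gt_eqF ?sqrtr_gt0 ?gt_eqF//; lra.
  apply: (@le_trans _ _ ((4 * (A + 4) + 3) * (n%:R / ln (n%:R : R)))).
    rewrite [leRHS]mulrDl lerD//; last by lra.
    by rewrite ler_wpM2l//; lra.
  by rewrite ler_wpM2r//; lra.
Unshelve. all: by end_near.
Qed.
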